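(* Let $r, s \geq 1$ with $1/r + 1/s > 1$. There are constants $c, C>0$ such that for every natural number $k$ and every $\eta \in (0,1)$ there exist finite sums $\mu_k$ and $\nu_k$ of point masses in $\mathbb{R}^3$ such that (a) $\langle \mathcal M_{\mathfrak z,d}\, \mu_k , \nu_k \rangle \geq c\, 2^k$, and (b) $\displaystyle\sum_{R\in \mathscr{S}_{\mathfrak z}} \langle \mu_k \rangle_{R,r}\, \langle \nu_k \rangle_{R,s}\, |R| \leq \frac{C}{\eta}\, k^{1/s} \left( 1 + \frac{1}{k} \right)$ for all $\eta$-sparse collections $\mathscr{S}_{\mathfrak z}$ of Zygmund dyadic rectangles.
   Context: $\mathscr{D}$ denotes the dyadic intervals $[k2^{-j},(k+1)2^{-j})$, $j,k\in\mathbb{Z}$. A Zygmund dyadic rectangle is $R=I\times J\times S$ with $I,J,S\in\mathscr{D}$ and $|S|=|I|\cdot|J|$. For a finite set $\mathcal F\subset\mathbb{R}^3$, the associated finite sum of point masses is $\mu=\frac{1}{\sharp\mathcal F}\sum_{p\in\mathcal F}\delta_p$. For such $\mu$ (with set $\mathcal F$) and $\nu$ (with set $\mathcal G$): $\mathcal M_{\mathfrak z,d}\,\mu(x)=\frac{1}{\sharp\mathcal F}\sup_{R}\frac{\sharp(R\cap\mathcal F)}{|R|}$, supremum over Zygmund dyadic rectangles $R\ni x$; $\langle h,\nu\rangle=\frac{1}{\sharp\mathcal G}\sum_{q\in\mathcal G}h(q)$; and for $1\le r<\infty$, $\langle\mu\rangle_{R,r}=\frac{1}{\sharp\mathcal F}\big(\frac{\sharp(R\cap\mathcal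 F)}{|R|}\big)^{1/r}$. For $\eta\in(0,1)$, a collection $\mathscr{S}$ of sets of finite measure is $\eta$-sparse if for each $R\in\mathscr{S}$ there is a measurable $E_R\subset R$ with $|E_R|\ge\eta|R|$ and the sets $E_R$ are pairwise disjoint. *)

(* Defs.v *)
From HB Require Import structures.
From mathcomp Require Import all_boot all_order all_algebra.
From mathcomp Require Import all_classical all_reals all_analysis.
Set Implicit Arguments. Unset Strict Implicit. Unset Printing Implicit Defensive.
Import Order.TTheory GRing.Theory Num.Theory.
Import numFieldNormedType.Exports.
Local Open Scope classical_set_scope.
Local Open Scope ring_scope.

Section Zygmund.
Variable R : realType.

Definition pt3 := ((R * R) * R)%type.

Definition dyadic (j k : int) : set R :=
  [set x | k%:~R * (2:R) ^ (- j) <= x < (k + 1)%:~R * (2:R) ^ (- j)].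

(* A Zygmund dyadic rectangle I x J x S with I = dyadic j1 k1, J = dyadic j2 k2,
   and S = dyadic (j1 + j2) k3, so that |S| = |I| |J|.
   It is coded by ((j1, k1), (j2, k2), k3); distinct codes give distinct sets. *)
Definition zrect := ((int * int) * (int * int) * int)%type.

Definition zj1 (Q : zrect) : int := Q.1.1.1.
Definition zk1 (Q : zrect) : int := Q.1.1.2.
Definition zj2 (Q : zrect) : int := Q.1.2.1.
Definition zk2 (Q : zrect) : int := Q.1.2.2.
Definition zk3 (Q : zrect) : int := Q.2.

Definition zset (Q : zrect) : set pt3 :=
  [set p | dyadic (zj1 Q) (zk1 Q) p.1.1 /\ dyadic (zj2 Q) (zk2 Q) p.1.2
           /\ dyadic (zj1 Q + zj2 Q) (zk3 Q) p.2].

(* |R| = |I| |J| |S| = 2^(-2(j1+j2)) *)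
Definition zvol (Q : zrect) : R := (2:R) ^ (- (2 * (zj1 Q + zj2 Q))).

(* a finite set F of points is given by a duplicate-free nonempty list *)
Definition ptcount (F : seq pt3) (A : set pt3) : nat :=
  size [seq p <- F | `[< A p >]].

Definition zdens (F : seq pt3) (Q : zrect) : R :=
  (ptcount F (zset Q))%:R / zvol Q.

(* dyadic Zygmund maximal function of mu = 1/#F sum_{p in F} delta_p (extended real) *)
Definition Mzd (F : seq pt3) (x : pt3) : \bar R :=
  ((size F)%:R^-1)%:E *
  ereal_sup [set (zdens F Q)%:E | Q in [set Q | zset Q x]].

(* <h, nu> for nu = 1/#G sum_{q in G} delta_q *)
Definition pair_nu (h : pt3 -> \bar R) (G : seq pt3) : \bar R :=
  ((size G)%:R^-1)%:E * (\sum_(q <- G) h q)%E.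

Definition avg_r (F : seq pt3) (Q : zrect) (r : R) : R :=
  (size F)%:R^-1 * (zdens F Q) `^ (r^-1).

Definition leb3 : set pt3 -> \bar R :=
  ((@lebesgue_measure R \x @lebesgue_measure R) \x @lebesgue_measure R)%E.

Definition sparse (eta : R) (S : set zrect) : Prop :=
  exists E : zrect -> set pt3,
    (forall Q, S Q -> [/\ measurable (E Q), E Q `<=` zset Q
                        & ((eta * zvol Q)%:E <= leb3 (E Q))%E]) /\
    (forall Q Q', S Q -> S Q' -> Q <> Q' -> E Q `&` E Q' = set0).

End Zygmund.

(* Main.v *)
Require Import Defs.
From HB Require Import structures.
From mathcomp Require Import all_boot all_order all_algebra.
From mathcomp Require Import all_classical all_reals all_analysis.
From mathcomp Require Import zify ring.
Set Implicit Arguments. Unset Strict Implicit. Unset Printing Implicit Defensive.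
Import Order.TTheory GRing.Theory Num.Theory.
Local Open Scope classical_set_scope.
Local Open Scope ring_scope.

(** Fix [m] binary digits.  The points of [F] are [(0.w, 0.rev w, z)] for all
    digit strings [w] and all grid values [z]; those of [G] are
    [(0.u, 0.rev v, z)], where [v] agrees with [u] on a window of length [k]
    starting at one of [T = m - k] positions and is the complement of [u]
    elsewhere.  An extra last digit, [0] on [F] and [1] on [G], separates the
    two sets.

    A rectangle fixing the first [a] digits of [u] and the last [b] digits of
    [v] has normalised density one for both sets as long as [a + b <= m].  If
    [a + b > m] and it meets both [F] and [G], then [u] and [v] agree on the
    overlap of the two digit ranges, so this overlap lies in the window: the
    rectangle holds one point of [F] and at most [k] of the [T * 4 ^ m] points
    of [G].  Hence every point of [G] sees an [F]-density [4 ^ k], while for [T]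
    huge the average of [G] over such rectangles compensates that density.

    Rectangles leaving the unit cube are grouped by the sizes
    [(2 ^ a, 2 ^ b, 2 ^ c)] of the smallest box at the origin containing them;
    their averages are at most [2 ^ - (a + b + c)] to the powers [1 / r] and
    [1 / s], and sparseness bounds their total volume by [2 ^ (a + b + c) / eta],
    so the groups sum up geometrically since [1 / r + 1 / s > 1]. *)

(** * Binary expansions and dyadic intervals *)

Fixpoint prefix_val (d : nat -> bool) (j : nat) : nat :=
  if j is i.+1 then ((prefix_val d i).*2 + d i)%N else 0%N.

Lemma prefix_val_inj (d d' : nat -> bool) (j : nat) :
  prefix_val d j = prefix_val d' j -> forall i, (i < j)%N -> d i = d' i.
Proof.
elim: j => // j IH /= e i.
have e1 : d j = d' j.
  by move/(congr1 odd): e; rewrite !oddD !odd_double /= !oddb.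
rewrite ltnS leq_eqVlt => /predU1P[-> //|]; apply: IH.
by move: e; rewrite e1 => /addIn/(congr1 half); rewrite !doubleK.
Qed.

Lemma eq_prefix_val (d d' : nat -> bool) (j : nat) :
  (forall i, (i < j)%N -> d i = d' i) -> prefix_val d j = prefix_val d' j.
Proof.
elim: j => //= j IH e; rewrite e// IH// => i ij; apply: e.
exact: ltnW.
Qed.

(** In integer form: cutting an expansion after [j] digits gives the index of the dyadic interval of
    level [j] containing it. *)
Lemma prefix_val_bounds (d : nat -> bool) (j n : nat) :
  (prefix_val d j * 2 ^ n <= prefix_val d (j + n) < (prefix_val d j).+1 * 2 ^ n)%N.
Proof.
elim: n => [|n /andP[l u]]; first by rewrite addn0 expn0 !muln1 leqnn /=.
rewrite addnS /= expnS; case: (d _) => /=; nia.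
Qed.

(** At level [j], [pos_part j] counts the digits that a dyadic interval fixes, and [neg_part j] is
    the exponent by which it outgrows the unit interval; [Negz n] is [- (n + 1)]. *)
Definition neg_part (j : int) : nat := if j is Negz n then n.+1 else 0%N.
Definition pos_part (j : int) : nat := if j is Posz n then n else 0%N.

Lemma pos_neg_part (j : int) : j = (pos_part j)%:Z - (neg_part j)%:Z.
Proof. by case: j => n /=; rewrite ?subr0// NegzE sub0r. Qed.

Section Digits.
Variable R : realType.

Definition digit_val (M : nat) (d : nat -> bool) : R :=
  (prefix_val d M)%:R / 2 ^+ M.

Lemma digit_val_itv (M : nat) (d : nat -> bool) : 0 <= digit_val M d < 1.
Proof.
rewrite /digit_val divr_ge0//= ltr_pdivrMr ?exprn_gt0// mul1r -natrX ltr_nat.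
by have := prefix_val_bounds d 0 M; rewrite add0n /= mul1n.
Qed.

Lemma dyadic_prefix_val (M j : nat) (d : nat -> bool) : (j <= M)%N ->
  dyadic j%:Z (prefix_val d j)%:Z (digit_val M d).
Proof.
move=> jM; rewrite /dyadic /= /digit_val.
have := prefix_val_bounds d j (M - j); rewrite subnKC// => /andP[l u].
rewrite ler_pdivlMr ?exprn_gt0// ltr_pdivrMr ?exprn_gt0//.
have -> : ((prefix_val d j)%:Z + 1)%:~R = (prefix_val d j).+1%:R :> R.
  by rewrite -PoszD addn1 -pmulrn.
have e : (2:R) ^ (- j%:Z) * 2 ^+ M = 2 ^+ (M - j).
  by rewrite -exprnN exprB// ?unitfE// mulrC.
by rewrite -!mulrA e -!natrX -pmulrn -!natrM ler_nat ltr_nat l.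
Qed.

Lemma dyadic_inj (j kappa kappa' : int) (x : R) :
  dyadic j kappa x -> dyadic j kappa' x -> kappa = kappa'.
Proof.
rewrite /dyadic /= => /andP[a b] /andP[c e].
have p : 0 < (2:R) ^ (- j) by rewrite exprz_gt0.
have := le_lt_trans a e; have := le_lt_trans c b.
rewrite !ltr_pM2r// !ltr_int; lia.
Qed.

Lemma ex_dyadic (j : int) (x : R) : exists kappa : int, dyadic j kappa x.
Proof.
have p : 0 < (2:R) ^ (- j) by rewrite exprz_gt0.
exists (Num.floor (x / 2 ^ (- j))); rewrite /dyadic /=.
by rewrite -ler_pdivlMr// -ltr_pdivrMr// floor_le_tmp floorD1_gt.
Qed.

Lemma ex_dyadic_digits (M j : nat) (d d' : nat -> bool) : (j <= M)%N ->
  (forall i, (i < j)%N -> d i = d' i) ->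
  exists2 kappa : int, dyadic j%:Z kappa (digit_val M d)
                     & dyadic j%:Z kappa (digit_val M d').
Proof.
move=> jM e; exists (prefix_val d j)%:Z; first exact: dyadic_prefix_val.
by rewrite (@eq_prefix_val d d' j e); exact: dyadic_prefix_val.
Qed.

(** For [0 <= j <= M] the index of the interval encodes the first [j] digits. For [j > M] the
    interval is shorter than the grid spacing [2 ^ - M], so both numbers coincide. Negative levels
    fix no digit. *)
Lemma dyadic_digits (M : nat) (d d' : nat -> bool) (j kappa : int) :
  dyadic j kappa (digit_val M d) -> dyadic j kappa (digit_val M d') ->
  forall i, (i < M)%N -> (i < pos_part j)%N -> d i = d' i.
Proof.
case: j => j dx dx' i iM /= // ij.
have [jM|Mj] := leqP j M.
  have e1 := dyadic_inj dx (dyadic_prefix_val d jM).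
  have e2 := dyadic_inj dx' (dyadic_prefix_val d' jM).
  by apply: (@prefix_val_inj d d' j) => //; apply/eqP; rewrite -eqz_nat -e1 -e2.
apply: (@prefix_val_inj d d' M) => //.
move: dx dx'; rewrite /dyadic /= /digit_val => /andP[l u] /andP[l' u'].
have p : 0 < (2:R) ^ (- Posz j) by rewrite exprz_gt0.
have le2 : (2:R) ^ (- Posz j) <= (2 ^+ M)^-1.
  by rewrite -exprnN lef_pV2 ?posrE ?exprn_gt0// ler_weXn2l// ?ler1n// ltnW.
have q : 0 < (2 ^+ M : R)^-1 by rewrite invr_gt0 exprn_gt0.
have h x y : x%:R / 2 ^+ M < (kappa + 1)%:~R * (2:R) ^ (- Posz j) ->
    kappa%:~R * (2:R) ^ (- Posz j) <= y%:R / 2 ^+ M -> (x < y.+1)%N.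
  rewrite rmorphD /= mulrDl mul1r => h1 h2.
  rewrite -(ltr_nat R) -addn1 natrD -(@ltr_pM2r _ (2 ^+ M)^-1)// mulrDl mul1r.
  by apply: (lt_le_trans h1); apply: lerD.
by apply/eqP; rewrite eqn_leq; apply/andP; split; rewrite -ltnS; apply: h.
Qed.

(** For [j >= 0] the unit interval is a union of intervals of level [j]. For [j < 0] an index
    [kappa >= 1] would put the left end, hence [x], beyond [1], so the interval starts at the
    origin. *)
Lemma dyadic_sub_itv (j kappa : int) (x : R) : 0 <= x < 1 -> dyadic j kappa x ->
  dyadic j kappa `<=` [set` `[0, (2 ^+ neg_part j : R)[ ].
Proof.
move=> /andP[x0 x1]; rewrite /dyadic /= => /andP[l u] y /= /andP[l' u'].
have p : 0 < (2:R) ^ (- j) by rewrite exprz_gt0.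
have k0 : 0 <= kappa.
  have := le_lt_trans x0 u; rewrite pmulr_lgt0// ltr0z; lia.
rewrite in_itv /=; apply/andP; split.
  by apply: le_trans l'; rewrite mulr_ge0 ?ler0z// ltW.
apply: (lt_le_trans u'); have := le_lt_trans l x1.
case: j p {u u' l l'} => n p /=.
  rewrite -exprnN ltr_pdivrMr ?ler_pdivrMr ?exprn_gt0// ?expr0 !mul1r.
  rewrite -natrX -[(2 ^ n)%:R]/((2 ^ n)%:Z%:~R) ltr_int ler_int; lia.
rewrite NegzE opprK -exprnP => kl.
suff -> : kappa = 0 by rewrite add0r mul1r.
apply/eqP; rewrite eq_le k0 andbT leNgt; apply/negP => k1.
suff : (1:R) <= kappa%:~R * 2 ^+ n.+1 by rewrite leNgt kl.
by apply: mulr_ege1; [rewrite ler1z -gtz0_ge1|rewrite exprn_ege1// ler1n].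
Qed.

End Digits.

(** * Clouds of digit strings and the count of their points in a rectangle *)

Lemma card_ord_itv (n lo hi : nat) :
  (#|[set i : 'I_n | (lo <= i < hi)%N]%SET| <= hi - lo)%N.
Proof.
rewrite cardE -(size_map val) -(size_iota lo (hi - lo)).
apply: uniq_leq_size; first by rewrite (map_inj_uniq val_inj) enum_uniq.
move=> x /mapP[i]; rewrite mem_enum inE => /andP[l u] ->.
by rewrite mem_iota l /= subnKC// (leq_trans l) // ltnW.
Qed.

Section Cloud.
Variables (R : realType) (m : nat).
Notation digits := {ffun 'I_m -> bool}.

(** Once the index is known, the digits on [A] and [A'] are forced. The map [h] erases them and
    stays injective on [B], so only the digits outside are counted. *)
Lemma card_agree (I : finType) (B : {set I * digits * digits}) (P : {set I})
    (A A' : {set 'I_m}) :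
  (forall x, x \in B -> x.1.1 \in P) ->
  (forall x y, x \in B -> y \in B -> x.1.1 = y.1.1 ->
     (forall i, i \in A -> x.1.2 i = y.1.2 i) /\
     (forall i, i \in A' -> x.2 i = y.2 i)) ->
  (#|B| <= #|P| * 2 ^ #|~: A| * 2 ^ #|~: A'|)%N.
Proof.
move=> BP agree.
pose h (x : I * digits * digits) :=
  (x.1.1, [set i | x.1.2 i]%SET :\: A, [set i | x.2 i]%SET :\: A')%SET.
have inj_h : {in B &, injective h}.
  move=> [[t u] v] [[t' u'] v'] xB yB [/= e e1 e2]; move: xB yB; rewrite -{}e => xB yB.
  have /= [ag1 ag2] := agree _ _ xB yB erefl.
  congr (_, _, _); apply/ffunP => i.
    have [/ag1//|iA] := boolP (i \in A).
    by move/setP/(_ i): e1; rewrite !inE (negbTE iA).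
  have [/ag2//|iA] := boolP (i \in A').
  by move/setP/(_ i): e2; rewrite !inE (negbTE iA).
rewrite -(card_in_imset inj_h) -!card_powerset -!cardsX; apply: subset_leq_card.
apply/fintype.subsetP => _ /imsetP[x xB ->]; rewrite !inE /= BP//=.
by apply/andP; split; apply/fintype.subsetP => i; rewrite !inE => /andP[].
Qed.

(** As [bit_coord] reads [m.+1] digits, the padding [e] enters as exactly one extra digit, the mark
    that tells the two clouds apart. *)
Definition digit_fun (w : 'I_m -> bool) (e : bool) (i : nat) : bool :=
  if insub i is Some o then w o else e.

Lemma digit_fun_ord w e (i : 'I_m) : digit_fun w e i = w i.
Proof. by rewrite /digit_fun valK. Qed.

Lemma digit_fun_last w e : digit_fun w e m = e.
Proof. by rewrite /digit_fun insubF// ltnn. Qed.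

Definition bit_coord (w : 'I_m -> bool) (e : bool) : R :=
  digit_val R m.+1 (digit_fun w e).

Lemma bit_coord_itv w e : 0 <= bit_coord w e < 1.
Proof. exact: digit_val_itv. Qed.

Lemma dyadic_bit_coord (w w' : 'I_m -> bool) (e e' : bool) (j kappa : int) :
  dyadic j kappa (bit_coord w e) -> dyadic j kappa (bit_coord w' e') ->
  forall i : 'I_m, (i < pos_part j)%N -> w i = w' i.
Proof.
move=> d d' i ij; have := dyadic_digits d d' (i := i).
by rewrite !digit_fun_ord; apply => //; rewrite ltnS ltnW.
Qed.

Lemma dyadic_bit_coord_level (w w' : 'I_m -> bool) (j kappa : int) :
  dyadic j kappa (bit_coord w false) -> dyadic j kappa (bit_coord w' true) ->
  (pos_part j <= m)%N.
Proof.
move=> d d'; rewrite leqNgt; apply/negP => mj.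
by have := dyadic_digits d d' (i := m) (ltnSn m) mj; rewrite !digit_fun_last.
Qed.

Lemma ex_dyadic_bit_coord (j : nat) (w w' : 'I_m -> bool) (e e' : bool) :
  (j <= m)%N -> (forall i : 'I_m, (i < j)%N -> w i = w' i) ->
  exists2 kappa : int, dyadic j%:Z kappa (bit_coord w e) & dyadic j%:Z kappa (bit_coord w' e').
Proof.
move=> jm ww; apply: ex_dyadic_digits; first exact: leqW.
move=> i ij; have im : (i < m)%N by exact: leq_trans jm.
by have := ww (Ordinal im) ij; rewrite -(digit_fun_ord w e) -(digit_fun_ord w' e').
Qed.

Lemma bit_coord_inj (w w' : 'I_m -> bool) (e : bool) :
  bit_coord w e = bit_coord w' e -> w =1 w'.
Proof.
move=> ee i; have [kappa d] := ex_dyadic m%:Z (bit_coord w e).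
by apply: (dyadic_bit_coord d (w' := w') (e' := e)); rewrite -?ee //=.
Qed.

(** Reading the second coordinate backwards makes a dyadic interval there fix the last digits. The
    third coordinate always ends in [false], so points of different clouds can share it. *)
Definition cloud_point (f : 'I_m -> bool) (e : bool) (w z : digits) : pt3 R :=
  (bit_coord w e, bit_coord (fun i => w (rev_ord i) (+) f (rev_ord i)) e, bit_coord z false).

Lemma zset_agree (Q : zrect) (f g : 'I_m -> bool) (e e' : bool) (w w' z z' : digits) :
  zset Q (cloud_point f e w z) -> zset Q (cloud_point g e' w' z') ->
  [/\ forall i : 'I_m, (i < pos_part (zj1 Q))%N -> w i = w' i,
      forall i : 'I_m, (m - pos_part (zj2 Q) <= i)%N -> w i (+) f i = w' i (+) g i
    & forall i : 'I_m, (i < pos_part (zj1 Q + zj2 Q))%N -> z i = z' i].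
Proof.
move=> [/= x [y u]] [/= x' [y' u']]; split => i hi.
- exact: (dyadic_bit_coord x x').
- have := dyadic_bit_coord y y' (i := rev_ord i); rewrite !rev_ordK; apply => /=.
  by have := ltn_ord i; lia.
- exact: (dyadic_bit_coord u u').
Qed.

Definition cloud (I : finType) (f : I -> 'I_m -> bool) (e : bool) : seq (pt3 R) :=
  [seq cloud_point (f x.1.1) e x.1.2 x.2 | x <- enum {: I * digits * digits}].

Lemma size_cloud (I : finType) (f : I -> 'I_m -> bool) (e : bool) :
  size (cloud f e) = (#|I| * 4 ^ m)%N.
Proof.
rewrite size_map -cardE !card_prod card_ffun card_bool card_ord -mulnA.
by rewrite -expnMn.
Qed.

Lemma cloud_uniq (I : finType) (f : I -> 'I_m -> bool) (e : bool) :
  (forall t t', f t =1 f t' -> t = t') -> uniq (cloud f e).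
Proof.
move=> finj; rewrite map_inj_uniq ?enum_uniq//.
move=> [[t w] z] [[t' w'] z'] [/= /bit_coord_inj/ffunP ew ey /bit_coord_inj/ffunP ->].
move: ey; rewrite ew => /bit_coord_inj ey; congr (_, _, _); apply: finj => i.
by have := ey (rev_ord i); rewrite rev_ordK; apply: addbI.
Qed.

Lemma ptcount_cloud (I : finType) (f : I -> 'I_m -> bool) (e : bool) (A : set (pt3 R)) :
  ptcount (cloud f e) A =
  #|[set x : I * digits * digits | `[< A (cloud_point (f x.1.1) e x.1.2 x.2) >] ]%SET|.
Proof.
rewrite /ptcount /cloud filter_map size_map cardE.
congr size; rewrite {2}/enum_mem -enumT; apply: eq_filter => x /=.
by rewrite inE.
Qed.

(** For a fixed index [t] the flips [f t] cancel, so [Q] fixes a head and a tail of [w] and a head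
    of [z]. Where head and tail overlap, truncated subtraction leaves the factor [2 ^ 0]. *)
Lemma ptcount_cloud_le (I : finType) (f : I -> 'I_m -> bool) (e : bool)
    (Q : zrect) (P : {set I}) :
  (forall t w z, zset Q (cloud_point (f t) e w z) -> t \in P) ->
  (ptcount (cloud f e) (zset Q) <= #|P| *
     2 ^ (m - pos_part (zj1 Q) - pos_part (zj2 Q)) *
     2 ^ (m - pos_part (zj1 Q + zj2 Q)))%N.
Proof.
move=> hP; rewrite ptcount_cloud.
set a := pos_part (zj1 Q); set b := pos_part (zj2 Q).
set c := pos_part _.
pose A := [set i : 'I_m | ((i < a) || (m - b <= i))%N]%SET.
pose A' := [set i : 'I_m | (i < c)%N]%SET.
apply: (leq_trans (@card_agree _ _ P A A' _ _)).
- by move=> x; rewrite inE => /asboolP/hP.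
- move=> [[t w] z] [[t' w'] z']; rewrite !inE /= => q q' e1.
  move: q'; rewrite -e1 => q'; have [h1 h2 h3] := zset_agree q q'.
  split => i; rewrite inE; last exact: h3.
  by move=> /orP[/h1//|/h2]; apply: addIb.
- apply: leq_mul; first (apply: leq_mul => //); apply: leq_pexp2l => //.
    rewrite subnAC; apply: leq_trans (card_ord_itv m a (m - b)).
    by apply/subset_leq_card/fintype.subsetP => i; rewrite !inE negb_or -leqNgt -ltnNge.
  apply: leq_trans (card_ord_itv m c m); apply/subset_leq_card/fintype.subsetP => i.
  by rewrite !inE -leqNgt => ->/=.
Qed.

End Cloud.

(** * Densities and averages of a cloud *)

Lemma pos_partD (i j : int) : (pos_part (i + j) <= pos_part i + pos_part j)%N.
Proof.
have := pos_neg_part i; have := pos_neg_part j.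
by case E : (i + j) => [n|n] /=; lia.
Qed.

(** The base-two logarithm of the volume of the box at the origin that contains [Q] whenever [Q]
    meets the unit cube. *)
Definition excess (Q : zrect) : nat :=
  (neg_part (zj1 Q) + neg_part (zj2 Q) + neg_part (zj1 Q + zj2 Q))%N.

Lemma zvol_gt0 (R : realType) (Q : zrect) : 0 < zvol R Q.
Proof. by rewrite exprz_gt0. Qed.

Lemma zvolE (R : realType) (Q : zrect) :
  zvol R Q * 2 ^+ (pos_part (zj1 Q) + pos_part (zj2 Q) + pos_part (zj1 Q + zj2 Q))
  = 2 ^+ excess Q.
Proof.
rewrite /zvol /excess !exprnP -expfzDr//; congr (_ ^ _).
have := pos_neg_part (zj1 Q); have := pos_neg_part (zj2 Q).
have := pos_neg_part (zj1 Q + zj2 Q); lia.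
Qed.

Lemma zdens_le (R : realType) (F : seq (pt3 R)) (Q : zrect) (d : R) :
  (ptcount F (zset Q))%:R *
    2 ^+ (pos_part (zj1 Q) + pos_part (zj2 Q) + pos_part (zj1 Q + zj2 Q))
    <= d * 2 ^+ excess Q -> zdens F Q <= d.
Proof.
rewrite -zvolE mulrA ler_pM2r ?exprn_gt0// => h.
by rewrite /zdens ler_pdivrMr// zvol_gt0.
Qed.

Lemma zdens_ge0 (R : realType) (F : seq (pt3 R)) (Q : zrect) : 0 <= zdens F Q.
Proof. by rewrite /zdens divr_ge0// ltW// zvol_gt0. Qed.

Lemma avg_r_ge0 (R : realType) (F : seq (pt3 R)) (Q : zrect) (r : R) :
  0 <= avg_r F Q r.
Proof. by rewrite mulr_ge0// ?invr_ge0// powR_ge0. Qed.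

(** The weight [1 / size F] stands outside the power and absorbs [size F] to the power [1 / r],
    which is at most [size F] since [1 <= r]. *)
Lemma avg_r_le (R : realType) (F : seq (pt3 R)) (Q : zrect) (r d : R) :
  1 <= r -> F != [::] -> 0 <= d -> zdens F Q <= (size F)%:R * d ->
  avg_r F Q r <= d `^ r^-1.
Proof.
move=> r1 F0 d0 h.
have sF : 1 <= (size F)%:R :> R by rewrite ler1n lt0n size_eq0.
have s0 : 0 < (size F)%:R :> R by exact: lt_le_trans sF.
have r0 : 0 <= r^-1 by rewrite invr_ge0 (le_trans _ r1).
rewrite /avg_r mulrC ler_pdivrMr// mulrC.
apply: (@le_trans _ _ (((size F)%:R * d) `^ r^-1)).
  by apply: ge0_ler_powR => //; rewrite nnegrE ?zdens_ge0// mulr_ge0.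
rewrite powRM// ler_wpM2r ?powR_ge0//.
rewrite -[leRHS]powRr1; last exact: ltW.
by apply: ler_powR => //; rewrite invf_le1// (lt_le_trans _ r1).
Qed.

Lemma avg_r_eq0 (R : realType) (F : seq (pt3 R)) (Q : zrect) (r : R) :
  1 <= r -> ptcount F (zset Q) = 0%N -> avg_r F Q r = 0.
Proof.
move=> r1 F0; rewrite /avg_r /zdens F0 mul0r powR0 ?mulr0//.
by rewrite invr_eq0 gt_eqF// (lt_le_trans _ r1).
Qed.

(** With [a], [b], [c] the three positive parts, [c <= a + b <= m] by [pos_partD], so no subtraction
    in [ptcount_cloud_le] is truncated. *)
Lemma zdens_cloud_le (R : realType) (m : nat) (I : finType)
    (f : I -> 'I_m -> bool) (e : bool) (Q : zrect) :
  (pos_part (zj1 Q) + pos_part (zj2 Q) <= m)%N ->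
  zdens (cloud R f e) Q <= (size (cloud R f e))%:R * (2 ^+ excess Q)^-1.
Proof.
move=> abm; apply: zdens_le; rewrite mulfVK ?expf_neq0// -natrX -natrM ler_nat.
have := @ptcount_cloud_le R m I f e Q [set: I]%SET (fun _ _ _ _ => finset.in_setT _).
rewrite cardsT size_cloud => h; apply: (leq_trans (leq_mul h (leqnn _))).
rewrite -!mulnA leq_mul2l -!expnD (_ : 4 = 2 ^ 2)%N// -expnM leq_exp2l// mulSn mul1n.
by apply/orP; right; have := pos_partD (zj1 Q) (zj2 Q); lia.
Qed.

(** * The two clouds and the product of their averages *)

Section Window.
Variables (R : realType) (T k : nat).
Let m := (T + k)%N.

Definition flip_outside_window (t : 'I_T) (i : 'I_m) : bool :=
  ~~ (t <= i < t + k)%N.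

Definition diag_cloud : seq (pt3 R) := cloud R (fun (_ : unit) (_ : 'I_m) => false) false.
Definition window_cloud : seq (pt3 R) := cloud R flip_outside_window true.

Lemma size_diag_cloud : size diag_cloud = (4 ^ m)%N.
Proof. by rewrite size_cloud card_unit mul1n. Qed.

Lemma size_window_cloud : size window_cloud = (T * 4 ^ m)%N.
Proof. by rewrite size_cloud card_ord. Qed.

Lemma diag_cloud_uniq : uniq diag_cloud.
Proof. by apply: cloud_uniq => [[] []]. Qed.

(** As [k > 0], [t] is recovered as the first position that is not flipped. *)
Lemma window_cloud_uniq : (0 < k)%N -> uniq window_cloud.
Proof.
move=> k0; apply: cloud_uniq => t t' e; apply/val_inj/eqP => /=.
have le_win (x y : 'I_T) : flip_outside_window x =1 flip_outside_window y -> (x <= y)%N.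
  have ym : (y < m)%N by rewrite ltn_addr.
  move=> /(_ (Ordinal ym)); rewrite /flip_outside_window /= leqnn -addn1 leq_add2l k0.
  by move=> /negbFE/andP[].
by rewrite eqn_leq !le_win// => i; rewrite e.
Qed.

Lemma ptcount_ex (F : seq (pt3 R)) (A : set (pt3 R)) :
  ptcount F A != 0%N -> exists2 p, p \in F & A p.
Proof.
rewrite /ptcount size_eq0 => h; have [p] : exists p, p \in [seq p <- F | `[< A p >]].
  by case: [seq _ <- _ | _] h => // p l _; exists p; rewrite mem_head.
by rewrite mem_filter => /andP[/asboolP Ap pF]; exists p.
Qed.

(** The extra digit bounds both levels by [m]. On the overlap of the digit ranges [w] equals both
    [u] and its flipped copy, so nothing is flipped there; testing the two ends of the overlap
    locates it in the window. *)
Lemma zset_level (Q : zrect) (w z u z' : {ffun 'I_m -> bool}) (t : 'I_T) :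
  zset Q (cloud_point R (fun=> false) false w z) ->
  zset Q (cloud_point R (flip_outside_window t) true u z') ->
  [/\ (pos_part (zj1 Q) <= m)%N, (pos_part (zj2 Q) <= m)%N
    & (m < pos_part (zj1 Q) + pos_part (zj2 Q))%N ->
      (pos_part (zj1 Q) <= t + k)%N && (t <= m - pos_part (zj2 Q))%N].
Proof.
move=> p q; have [h1 h2 _] := zset_agree p q.
case: p q => [/= p1 [p2 _]] [/= q1 [q2 _]].
have am := dyadic_bit_coord_level p1 q1; have bm := dyadic_bit_coord_level p2 q2.
split => // ab.
have win (i : nat) : (m - pos_part (zj2 Q) <= i < pos_part (zj1 Q))%N ->
    (t <= i < t + k)%N.
  move=> /andP[l u']; have im : (i < m)%N by exact: leq_trans am.
  have := h1 (Ordinal im) u'; have := h2 (Ordinal im) l => /= e2 e1.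
  move: e2; rewrite e1 => /addbI /=; rewrite /flip_outside_window /=.
  by move/esym/negbFE.
have /andP[_ w1] := win (pos_part (zj1 Q)).-1 ltac:(lia).
have /andP[w2 _] := win (m - pos_part (zj2 Q))%N ltac:(lia).
by rewrite w2 andbT; lia.
Qed.

Lemma avg_prod_le (Q : zrect) (r s : R) : (0 < k)%N -> (0 < T)%N ->
  1 <= r -> 1 <= s -> (k * 4 ^ k)%:R * ((4 ^ k)%:R `^ s) <= T%:R :> R ->
  ptcount diag_cloud (zset Q) != 0%N -> ptcount window_cloud (zset Q) != 0%N ->
  avg_r diag_cloud Q r * avg_r window_cloud Q s
    <= (2 ^+ excess Q)^-1 `^ (r^-1 + s^-1).
Proof.
move=> k0 T0 r1 s1 hT /ptcount_ex[_ /mapP[[[[] w] z] _ ->] p]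
  /ptcount_ex[_ /mapP[[[t u] z'] _ ->] q].
have dn : diag_cloud != [::] by rewrite -size_eq0 size_diag_cloud expn_eq0.
have wn : window_cloud != [::].
  by rewrite -size_eq0 size_window_cloud -lt0n muln_gt0 T0 expn_gt0.
have [/= am bm win] := zset_level p q.
have [ab|ab] := leqP (pos_part (zj1 Q) + pos_part (zj2 Q)) m.
  rewrite powRD; last by apply/implyP => _; rewrite invr_eq0 expf_neq0.
  have h0 : 0 <= (2 ^+ excess Q : R)^-1 by rewrite invr_ge0 exprn_ge0.
  by apply: ler_pM; rewrite ?avg_r_ge0// avg_r_le//; exact: zdens_cloud_le.
have /andP[t1 t2] := win ab.
(* Both levels are at most [m] and their sum exceeds [m], so both are positive and no side is longer
   than [1]. *)
have [a_gt0 b_gt0] : (0 < pos_part (zj1 Q))%N /\ (0 < pos_part (zj2 Q))%N by lia.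
have ex0 : excess Q = 0%N.
  rewrite /excess; case: (zj1 Q) (zj2 Q) a_gt0 b_gt0 => [a|a] [b|b] //=.
have cE : pos_part (zj1 Q + zj2 Q) = (pos_part (zj1 Q) + pos_part (zj2 Q))%N.
  by case: (zj1 Q) (zj2 Q) a_gt0 b_gt0 => [a|a] [b|b] //=.
rewrite ex0 expr0 invr1 powR1.
have c1 : (ptcount diag_cloud (zset Q) <= 1)%N.
  have := @ptcount_cloud_le R m _ (fun (_ : unit) (_ : 'I_m) => false) false Q
    [set: unit]%SET (fun _ _ _ _ => finset.in_setT _).
  rewrite cardsT card_unit cE -subnDA.
  by rewrite (_ : m - _ = 0)%N//; lia.
have c2 : (ptcount window_cloud (zset Q) <= k)%N.
  (* With levels [a] and [b], the admissible positions [a - k <= t <= m - b] number at most [k],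
     because [a + b >= m + 1]. *)
  pose P := [set x : 'I_T | (pos_part (zj1 Q) - k <= x < (m - pos_part (zj2 Q)).+1)%N]%SET.
  have hP x u' z'' : zset Q (cloud_point R (flip_outside_window x) true u' z'') -> x \in P.
    by move=> /(zset_level p)[_ _ /(_ ab)]; rewrite inE; lia.
  apply: leq_trans (ptcount_cloud_le hP) _.
  rewrite cE -subnDA (_ : m - _ = 0)%N; last lia.
  rewrite !muln1; apply: leq_trans (card_ord_itv _ _ _) _; lia.
(* From [a <= t + k] and [t <= m - b] follows [a + b <= m + k], so the reciprocal volume is at most
   [4 ^ (m + k)]. *)
have dens (F : seq (pt3 R)) n (d : R) : (ptcount F (zset Q) <= n)%N -> (n * 4 ^ (m + k))%:R <= d ->
    zdens F Q <= d.
  move=> cn h; apply: zdens_le; rewrite ex0 expr0 mulr1 cE; apply: le_trans h.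
  rewrite -natrX -natrM ler_nat leq_mul// (_ : 4 = 2 ^ 2)%N// -expnM leq_exp2l//; lia.
have k4 : 1 <= (4 ^ k)%:R :> R by rewrite ler1n expn_gt0.
have k40 : 0 < (4 ^ k)%:R :> R by exact: lt_le_trans k4.
have a1 : avg_r diag_cloud Q r <= (4 ^ k)%:R.
  apply: (@le_trans _ _ ((4 ^ k)%:R `^ r^-1)).
    apply: avg_r_le => //; apply: (dens _ 1%N) => //.
    by rewrite size_diag_cloud -natrM mul1n -expnD.
  rewrite -[leRHS]powRr1; last exact: ltW.
  by apply: ler_powR => //; rewrite invf_le1// (lt_le_trans _ r1).
have T0' : 0 < T%:R :> R by rewrite ltr0n.
have s0 : 0 < s by exact: lt_le_trans s1.
have a2 : avg_r window_cloud Q s <= (4 ^ k)%:R^-1.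
  apply: (@le_trans _ _ (((k * 4 ^ k)%:R / T%:R) `^ s^-1)).
    apply: avg_r_le => //; apply: (dens _ k) => //.
    rewrite size_window_cloud.
    have -> // : (T * 4 ^ m)%:R * ((k * 4 ^ k)%:R / T%:R) = (k * 4 ^ (m + k))%:R :> R.
    by rewrite expnD !natrM; field; rewrite gt_eqF.
  (* The hypothesis on [T] bounds [k * 4 ^ k / T] by [4 ^ k] to the power [- s], whose [1 / s]-th
     power cancels the bound [a1]. *)
  have -> : (4 ^ k)%:R^-1 = ((4 ^ k)%:R `^ (- s)) `^ s^-1 :> R.
    by rewrite -powRrM mulNr divff ?gt_eqF// powR_inv1// ltW.
  apply: ge0_ler_powR; rewrite ?nnegrE ?powR_ge0// ?invr_ge0 ?divr_ge0//; first exact: ltW.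
  by rewrite powRN ler_pdivrMr// mulrC ler_pdivlMr// powR_gt0.
apply: (le_trans (ler_pM _ _ a1 a2)); rewrite ?avg_r_ge0//.
by rewrite divff ?gt_eqF.
Qed.

End Window.

(** * Lower bound for the maximal function *)

Lemma Mzd_window_cloud (R : realType) (T k : nat) (q : pt3 R) :
  q \in window_cloud R T k -> ((2 ^+ k)%:E <= Mzd (diag_cloud R T k) q)%E.
Proof.
move=> /mapP[[[t u] z] _ ->] /=.
(* [w] follows [u] up to the end of the window and the flipped copy of [u] after it. Inside the
   window the two agree, so [w] shares [t + k] leading digits with [u] and [T + k - t] trailing ones
   with the flipped copy. *)
pose w : {ffun 'I_(T + k) -> bool} :=
  [ffun i : 'I_(T + k) => if (i < t + k)%N then u i else u i (+) flip_outside_window t i].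
have tT := ltn_ord t.
have [k1 p1 q1] : exists2 kappa : int,
    dyadic (t + k)%:Z kappa (bit_coord R w false) & dyadic (t + k)%:Z kappa (bit_coord R u true).
  by apply: ex_dyadic_bit_coord => [|i h]; [lia|rewrite ffunE h].
have [k2 p2 q2] : exists2 kappa : int,
    dyadic (T + k - t)%:Z kappa (bit_coord R (fun i => w (rev_ord i) (+) false) false)
  & dyadic (T + k - t)%:Z kappa
      (bit_coord R (fun i => u (rev_ord i) (+) flip_outside_window t (rev_ord i)) true).
  apply: ex_dyadic_bit_coord => [|i h]; first lia.
  rewrite addbF ffunE; case: ltnP => // lt.
  rewrite /flip_outside_window lt andbT /= (_ : (t <= _)%N) ?addbF//; lia.
have [k3 p3] := ex_dyadic ((t + k)%:Z + (T + k - t)%:Z) (bit_coord R z false).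
pose Q : zrect := (((t + k)%:Z, k1), ((T + k - t)%:Z, k2), k3).
have Qp : zset Q (cloud_point R (fun=> false) false w z) by [].
have cnt : (0 < ptcount (diag_cloud R T k) (zset Q))%N.
  rewrite /ptcount -has_predT; apply/hasP.
  exists (cloud_point R (fun=> false) false w z) => //.
  rewrite mem_filter; apply/andP; split; first exact/asboolP.
  by apply/mapP; exists (tt, w, z) => //; rewrite mem_enum.
rewrite /Mzd; apply: (@le_trans _ _
    (((size (diag_cloud R T k))%:R^-1)%:E * (zdens (diag_cloud R T k) Q)%:E)%E); last first.
  apply: lee_wpmul2l; first by rewrite lee_fin invr_ge0.
  by apply: ereal_sup_ubound; exists Q.
rewrite -EFinM lee_fin size_diag_cloud mulrC ler_pdivlMr ?ltr0n ?expn_gt0//.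
(* With [m = T + k], a single point in a rectangle of volume [4 ^ - (m + k)], out of [4 ^ m] points,
   already gives [4 ^ k >= 2 ^ k]. *)
rewrite /zdens ler_pdivlMr ?zvol_gt0//; apply: (@le_trans _ _ 1); last by rewrite ler1n.
have -> : zvol R Q = (2 ^+ (2 * (T + k + k)))^-1.
  rewrite /zvol exprnN; congr (_ ^ (- _)); rewrite /Q /zj1 /zj2 /=; lia.
rewrite ler_pdivrMr ?exprn_gt0// mul1r -!natrX -natrM ler_nat.
rewrite (_ : 4 = 2 ^ 2)%N// -expnM -expnD leq_exp2l//; lia.
Qed.

Lemma pair_nu_ge (R : realType) (h : pt3 R -> \bar R) (G : seq (pt3 R)) (c : R) :
  G != [::] -> (forall q, q \in G -> (c%:E <= h q)%E) -> (c%:E <= pair_nu h G)%E.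
Proof.
move=> G0 hc; rewrite /pair_nu.
have s0 : 0 < (size G)%:R :> R by rewrite ltr0n lt0n size_eq0.
apply: (@le_trans _ _ (((size G)%:R^-1)%:E * (\sum_(q <- G) c%:E))%E).
  rewrite sumEFin -EFinM lee_fin big_const_seq count_predT iter_addr_0.
  by rewrite -(mulr_natr c) mulrCA mulVf ?gt_eqF// mulr1.
apply: lee_wpmul2l; first by rewrite lee_fin invr_ge0.
by rewrite big_seq [leRHS]big_seq; exact: lee_sum.
Qed.

(** * Summation over sparse collections *)

Definition box (R : realType) (a b c : nat) : set (pt3 R) :=
  ([set` `[0, (2 ^+ a : R)[ ] `*` [set` `[0, (2 ^+ b : R)[ ]) `*` [set` `[0, (2 ^+ c : R)[ ].
Arguments box : clear implicits.

Lemma measurable_box (R : realType) (a b c : nat) : measurable (box R a b c).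
Proof. by apply: measurableX => //; exact: measurableX. Qed.

Lemma leb3_box (R : realType) (a b c : nat) :
  leb3 (box R a b c) = (2 ^+ (a + b + c))%:E.
Proof.
have mu n : lebesgue_measure ([set` `[0, (2 ^+ n : R)[ ] : set R) = (2 ^+ n)%:E.
  by rewrite lebesgue_measure_itv /= lte_fin exprn_gt0// oppr0 adde0.
rewrite /leb3 /box product_measure1E//=; last exact: measurableX.
by rewrite product_measure1E//= !mu -!EFinM -!exprD.
Qed.

Lemma sum_leb3_le (R : realType) (D : seq zrect) (P : pred zrect)
    (E : zrect -> set (pt3 R)) (B : set (pt3 R)) :
  uniq D -> measurable B ->
  (forall Q, Q \in D -> P Q -> measurable (E Q) /\ E Q `<=` B) ->
  (forall Q Q', Q \in D -> Q' \in D -> Q <> Q' -> E Q `&` E Q' = set0) ->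
  (\sum_(Q <- D | P Q) leb3 (E Q) <= leb3 B)%E.
Proof.
move=> uD mB mE dE; rewrite -big_filter fsbig_seq ?filter_uniq//.
have mE' Q : [set` [seq Q <- D | P Q]] Q -> measurable (E Q) /\ E Q `<=` B.
  by rewrite /= mem_filter => /andP[PQ QD]; exact: mE.
rewrite /leb3 -measure_fin_bigcup//=; last first.
- by move=> Q /mE'[].
- apply/trivIsetP => Q Q'; rewrite /= !mem_filter => /andP[_ QD] /andP[_ Q'D] /eqP.
  exact: dE.
- exact: finite_seq.
- apply: le_measure; rewrite ?inE//.
    by apply: fin_bigcup_measurable => [|Q /mE'[]//]; exact: finite_seq.
  by apply: bigcup_sub => Q /mE'[].
Qed.

Lemma sum_geometric_le (R : realType) (x : R) (n : nat) : 0 <= x < 1 ->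
  \sum_(i < n) x ^+ i <= (1 - x)^-1.
Proof.
move=> /andP[x0 x1]; rewrite -div1r ler_pdivlMr ?subr_gt0// mulrC.
by rewrite -[1 - x]opprB mulNr -subrX1 opprB lerBlDr lerDl exprn_ge0.
Qed.

(** In a class with excess [l] the disjoint sets [E Q] fill at most a box of volume [2 ^ l], so the
    class contributes at most [x ^ l / eta]. Summing over the three exponents gives the cube of a
    geometric series. *)
Lemma sparse_esum_le (R : realType) (eta x : R) (S : set zrect) (g : zrect -> R) :
  0 < eta -> 0 <= x < 1 -> sparse eta S ->
  (forall Q, 0 <= g Q) ->
  (forall Q, g Q != 0 -> g Q <= (x / 2) ^+ excess Q /\
     zset Q `<=` box R (neg_part (zj1 Q)) (neg_part (zj2 Q)) (neg_part (zj1 Q + zj2 Q))) ->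
  (\esum_(Q in S) (g Q * zvol R Q)%:E <= ((1 - x)^-1 ^+ 3 / eta)%:E)%E.
Proof.
move=> eta0 x01 [E [SE dE]] g0 hg; have /andP[x0 x1] := x01.
apply: ge_ereal_sup => _ [A [finA AS] <-].
rewrite fsbig_finite// sumEFin lee_fin.
set D := finmap.enum_fset (fset_set A).
have DS Q : Q \in D -> S Q by rewrite /D in_fset_set// inE => /AS.
have uD : uniq D by exact: finmap.fset_uniq.
(* [N] exceeds every exponent met in the finite set [D], so the classes form a finite type and
   [inord] loses nothing. *)
pose N := (\sum_(Q <- D) excess Q).+1.
have DN Q : Q \in D -> (excess Q < N)%N.
  by move=> QD; rewrite ltnS (bigD1_seq Q)//= leq_addr.
pose cl Q : 'I_N * 'I_N * 'I_N := (inord (neg_part (zj1 Q)), inord (neg_part (zj2 Q)),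
  inord (neg_part (zj1 Q + zj2 Q))).
pose lev (c : 'I_N * 'I_N * 'I_N) := (c.1.1 + c.1.2 + c.2)%N.
have clE Q : Q \in D -> lev (cl Q) = excess Q /\ box R (cl Q).1.1 (cl Q).1.2 (cl Q).2 =
    box R (neg_part (zj1 Q)) (neg_part (zj2 Q)) (neg_part (zj1 Q + zj2 Q)).
  move=> /DN; rewrite /lev /cl /excess /= => h; rewrite !inordK//; lia.
apply: (@le_trans _ _ (\sum_c x ^+ lev c / eta)); last first.
  rewrite -mulr_suml ler_wpM2r ?invr_ge0 ?(ltW eta0)//.
  have -> : \sum_c x ^+ lev c = (\sum_(i < N) x ^+ i) ^+ 3.
    rewrite -(pair_bigA _ (fun (p : 'I_N * 'I_N) (i : 'I_N) => x ^+ (p.1 + p.2 + i))) /=.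
    rewrite -(pair_bigA _ (fun i j : 'I_N => \sum_(l < N) x ^+ (i + j + l))) /=.
    rewrite !exprS expr0 mulr1 mulr_suml; apply: eq_bigr => i _.
    rewrite mulr_suml mulr_sumr; apply: eq_bigr => j _.
    by rewrite mulrA mulr_sumr; apply: eq_bigr => l _; rewrite !exprD.
  rewrite lerXn2r ?sum_geometric_le// nnegrE.
    by apply: sumr_ge0 => i _; rewrite exprn_ge0.
  by rewrite invr_ge0 subr_ge0 ltW.
rewrite (bigID (fun Q => g Q != 0)) /= [X in _ + X]big1 ?addr0; last first.
  by move=> Q /negPn/eqP ->; rewrite mul0r.
rewrite (partition_big cl xpredT)//=; apply: ler_sum => c _.
rewrite -lee_fin -sumEFin.
(* [M] is the cost per unit of [leb3 (E Q)]: dividing by [eta] pays for passing from [zvol R Q] to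
   [leb3 (E Q)]. *)
pose M : R := (x / 2) ^+ lev c / eta.
have M0 : 0 <= M by rewrite divr_ge0 ?exprn_ge0 ?divr_ge0// ltW.
apply: (@le_trans _ _ (M%:E *
    \sum_(Q <- D | (g Q != 0)%R && (cl Q == c)) leb3 (E Q))%E).
  rewrite ge0_sume_distrr//.
  rewrite big_seq_cond [leRHS]big_seq_cond; apply: lee_sum => Q /and3P[QD gQ /eqP cQ].
  have [mE EQ lE] := SE _ (DS _ QD).
  apply: (@le_trans _ _ (M%:E * (eta * zvol R Q)%:E)%E); last first.
    by apply: lee_wpmul2l; rewrite ?lee_fin.
  rewrite -EFinM lee_fin mulrA /M mulfVK ?gt_eqF// ler_pM2r ?zvol_gt0//.
  by rewrite -cQ; have [-> _] := clE _ QD; case: (hg _ gQ).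
apply: (@le_trans _ _ (M%:E * leb3 (box R c.1.1 c.1.2 c.2))%E).
  apply: lee_wpmul2l; first by rewrite lee_fin.
  apply: sum_leb3_le => //; first exact: measurable_box.
    move=> Q QD /andP[gQ /eqP <-]; have [mE EQ _] := SE _ (DS _ QD).
    split=> //; have [_ ->] := clE _ QD; apply: subset_trans EQ _.
    by case: (hg _ gQ).
  by move=> Q Q' /DS QS /DS QS'; exact: dE.
rewrite leb3_box -EFinM lee_fin /M mulrAC exprMn exprVn mulfVK// expf_neq0//.
Qed.

(** * Choice of the parameters and conclusion *)

Theorem theorem2p1 (R : realType) (r s : R) :
  1 <= r -> 1 <= s -> 1 < r^-1 + s^-1 ->
  exists c C : R, 0 < c /\ 0 < C /\
    forall k : nat, (0 < k)%N ->
    forall eta : R, 0 < eta -> eta < 1 ->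
    exists F G : seq (pt3 R),
      F != [::] /\ uniq F /\ G != [::] /\ uniq G /\
        ((c * 2 ^+ k)%:E <= pair_nu (Mzd F) G)%E /\
        forall S : set (zrect),
          sparse eta S ->
          (\esum_(Q in S) (avg_r F Q r * avg_r G Q s * zvol R Q)%:E
             <= (C / eta * (k%:R) `^ (s^-1) * (1 + k%:R^-1))%:E)%E.
Proof.
(* With this [x], [2 ^ - l] to the power [1 / r + 1 / s] is [(x / 2) ^ l], and [1 / r + 1 / s > 1]
   becomes [x < 1]. *)
move=> r1 s1 rs; pose delta := r^-1 + s^-1 - 1; pose x : R := 2^-1 `^ delta.
have delta0 : 0 < delta by rewrite subr_gt0.
have x0 : 0 <= x by exact: powR_ge0.
have x1 : x < 1.
  rewrite (_ : 1 = 1 `^ delta); last by rewrite powR1.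
  apply: gt0_ltr_powR; rewrite ?nnegrE//.
  by rewrite invf_lt1// ltr1n.
exists 1, ((1 - x)^-1 ^+ 3); split => //; split.
  by rewrite exprn_gt0// invr_gt0 subr_gt0.
move=> k k0 eta eta0 eta1.
(* Large enough for [avg_prod_le]; the successor makes [T] positive. *)
pose T := (Num.bound ((k * 4 ^ k)%:R * ((4 ^ k)%:R `^ s) : R)).+1.
have hT : (k * 4 ^ k)%:R * ((4 ^ k)%:R `^ s) <= T%:R :> R.
  apply/ltW/(lt_le_trans (archi_boundP _)); last by rewrite ler_nat.
  by rewrite mulr_ge0// powR_ge0.
have wn : window_cloud R T k != [::].
  by rewrite -size_eq0 size_window_cloud -lt0n muln_gt0 expn_gt0.
exists (diag_cloud R T k), (window_cloud R T k).
split; first by rewrite -size_eq0 size_diag_cloud expn_eq0.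
split; first exact: diag_cloud_uniq.
split=> //; split; first exact: window_cloud_uniq.
split; first by rewrite mul1r; apply: pair_nu_ge => // q; exact: Mzd_window_cloud.
move=> S sS.
pose g Q := avg_r (diag_cloud R T k) Q r * avg_r (window_cloud R T k) Q s.
have x01 : 0 <= x < 1 by rewrite x0.
apply: (@le_trans _ _ ((1 - x)^-1 ^+ 3 / eta)%:E).
  apply: (@sparse_esum_le R eta x S g) => //.
    by move=> Q; rewrite mulr_ge0// avg_r_ge0.
  move=> Q; rewrite /g mulf_eq0 negb_or => /andP[gF gG].
  have cF : ptcount (diag_cloud R T k) (zset Q) != 0%N.
    by apply: contra gF => /eqP cF; rewrite avg_r_eq0.
  have cG : ptcount (window_cloud R T k) (zset Q) != 0%N.
    by apply: contra gG => /eqP cG; rewrite avg_r_eq0.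
  split.
    apply: (le_trans (avg_prod_le _ _ r1 s1 hT cF cG)) => //.
    rewrite -exprVn -(@powR_mulrn _ 2^-1)// -powRrM mulrC powRrM powR_mulrn ?powR_ge0//.
    rewrite (_ : r^-1 + s^-1 = delta + 1); last by rewrite subrK.
    by rewrite powRD ?powRr1//; apply/implyP.
  have [_ /mapP[[[[] w] z] _ ->] [/= p1 [p2 p3]]] := ptcount_ex cF.
  move=> [[y1 y2] y3] [/= h1 [h2 h3]].
  split; last exact: (dyadic_sub_itv (bit_coord_itv _ _ _) p3).
  split; first exact: (dyadic_sub_itv (bit_coord_itv _ _ _) p1).
  exact: (dyadic_sub_itv (bit_coord_itv _ _ _) p2).
(* It remains to see that [k] to the power [1 / s], times [1 + 1 / k], is at least [1]. *)
rewrite lee_fin -[leRHS]mulrA ler_peMr//.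
  by rewrite divr_ge0 ?exprn_ge0 ?invr_ge0 ?subr_ge0// ltW.
rewrite mulr_ege1//; last by rewrite lerDl invr_ge0.
rewrite -[leLHS](powRr0 k%:R); apply: ler_powR; first by rewrite ler1n.
by rewrite invr_ge0 (le_trans _ s1).
Qed.
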